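(* Let $O$, $O_F$ ($F\in\mathcal F$) and $O_{\mathcal F}=\bigcap_{F\in\mathcal F}O_F$ be as defined in the context. If $O_{\mathcal F}\cap O\neq\emptyset$, then every $\theta^*\in O_{\mathcal F}\cap O$ ensures the invariance of the rectangle $R$ under an admissible feedback: $\mathcal H(x)\theta^*\in\mathcal U$ for all $x\in R$, and every trajectory of the closed-loop system $\dot x=f(x)+G(x)\theta^*$ with $x(0)\in R$ satisfies $x(t)\in R$ for all $t\ge 0$.
   Context: System: $\dot x=f(x)+g(x)u$, $y=h(x)$, with state $x\in\mathbb R^n$, input $u\in\mathcal U\subset\mathbb R^p$ and output $y\in\mathbb R^q$. The maps $f:\mathbb R^n\to\mathbb R^n$, $g:\mathbb R^n\to\mathbb R^{n\times p}$, $h:\mathbb R^n\to\mathbb R^q$ are multivariate polynomial maps. The input set is a compact convex polytope $\mathcal U=\{u\in\mathbb R^p : \alpha_{\mathcal U,k}\cdot u\le\beta_{\mathcal U,k}\ \forall k\in\mathcal K_{\mathcal U}\}$, with $\mathcal K_{\mathcal U}$ a finite index set, $\alpha_{\mathcal U,k}\in\mathbb R^p$ and $\beta_{\mathcal U,k}\in\mathbb R$. Region: $R=[\underline{x_1},\overline{x_1}]\times\dots\times[\underline{x_n},\overline{x_n}]$ with $\underline{x_k}<\overline{x_k}$ for all $k$. $\mathcal F$ denotes the set of its $2n$ (closed) facets; for $F\in\mathcal F$, $n_F$ is the outer unit normal of $F$ (that is, $-e_j$ for the facet $x_j=\underline{x_j}$ and $e_j$ for the facet $x_j=\overline{x_j}$,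 with $e_j$ the canonical basis vectors). Feedback: $u=H(y)\theta$, where $\theta\in\mathbb R^q$ is a vector of gain parameters and $H$ is a given polynomial map from the output space to $\mathbb R^{p\times q}$. Put $\mathcal H(x)=H(h(x))$ and $G(x)=g(x)\mathcal H(x)$, so the closed-loop system is $\dot x=f(x)+G(x)\theta$. Standing assumption of the paper: $0_n$ (the origin) is an equilibrium of the closed-loop system. Admissible gains: $O=\{\theta\in\mathbb R^q : \alpha_{\mathcal U,k}\cdot\mathcal H(x)\theta\le\beta_{\mathcal U,k}\ \forall k\in\mathcal K_{\mathcal U},\ \forall x\in R\}$. Blocked facets: a facet $F$ of $R$ is blocked for $\dot x=f(x)+G(x)\theta$ if $n_F\cdot(f(x)+G(x)\theta)<0$ for all $x\in F$. For $F\in\mathcal F$, $O_F\subseteq\mathbb R^q$ is a set of gains such that every $\theta\in O_F$ satisfies $\max_{x\in F}n_F\cdot(f(x)+G(x)\theta)<0$, i.e. $F$ is blocked. *)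

(* Defs.v *)
(* Vectors of R^n are column matrices 'cV[R]_n. *)
From HB Require Import structures.
From mathcomp Require Import all_boot all_order all_algebra.
From mathcomp Require Import all_classical all_reals all_analysis.
(* Not imported: the notations of mpoly clash with those of the analysis
   library, so {mpoly R[n]} is written mpoly.mpoly n R. *)
From mathcomp Require mpoly.

Set Implicit Arguments.
Unset Strict Implicit.
Unset Printing Implicit Defensive.

Import Order.TTheory GRing.Theory Num.Theory.
Import numFieldNormedType.Exports.

Local Open Scope classical_set_scope.
Local Open Scope ring_scope.

Definition dotv (R : realType) (n : nat) (a b : 'cV[R]_n) : R :=
  \sum_(i < n) a i 0 * b i 0.

(* A matrix of polynomials in n variables, read as a polynomial map from R^n. *)
Definition polymap (R : realType) (n m k : nat)
    (P : 'M[mpoly.mpoly n R]_(m, k)) (x : 'cV[R]_n) : 'M[R]_(m, k) :=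
  map_mx (mpoly.meval (fun i => x i 0)) P.

Definition polytope (R : realType) (p : nat) (K : finType)
    (alpha : K -> 'cV[R]_p) (beta : K -> R) : set 'cV[R]_p :=
  [set u | forall k : K, dotv (alpha k) u <= beta k].

Definition rectangle (R : realType) (n : nat) (lo hi : 'cV[R]_n) :
    set 'cV[R]_n :=
  [set x | forall i : 'I_n, lo i 0 <= x i 0 <= hi i 0].

(* The 2n facets are indexed by pairs (j, b): x_j equals its lower bound for
   b = false and its upper bound for b = true. *)
Definition facet_index (n : nat) : Type := ('I_n * bool)%type.

Definition facet (R : realType) (n : nat) (lo hi : 'cV[R]_n)
    (F : facet_index n) : set 'cV[R]_n :=
  [set x | rectangle lo hi x /\
           x F.1 0 = if F.2 then hi F.1 0 else lo F.1 0].

Definition outer_normal (R : realType) (n : nat) (F : facet_index n) :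
    'cV[R]_n :=
  if F.2 then delta_mx F.1 0 else - delta_mx F.1 0.

Definition is_max (R : realType) (A : set R) (m : R) : Prop :=
  A m /\ ubound A m.

Section ClosedLoop.

Variables (R : realType) (n p q : nat).
Variables (f : 'cV[mpoly.mpoly n R]_n) (g : 'M[mpoly.mpoly n R]_(n, p)).
Variables (h : 'cV[mpoly.mpoly n R]_q) (H : 'M[mpoly.mpoly q R]_(p, q)).

Definition state_gain (x : 'cV[R]_n) : 'M[R]_(p, q) :=
  polymap H (polymap h x).

Definition gain_field (x : 'cV[R]_n) : 'M[R]_(n, q) :=
  polymap g x *m state_gain x.

Definition closed_loop (theta : 'cV[R]_q) (x : 'cV[R]_n) : 'cV[R]_n :=
  polymap f x + gain_field x *m theta.

End ClosedLoop.

Definition admissible_gains (R : realType) (n p q : nat)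
    (h : 'cV[mpoly.mpoly n R]_q) (H : 'M[mpoly.mpoly q R]_(p, q))
    (K : finType) (alpha : K -> 'cV[R]_p) (beta : K -> R)
    (lo hi : 'cV[R]_n) : set 'cV[R]_q :=
  [set theta | forall (k : K) (x : 'cV[R]_n), rectangle lo hi x ->
     dotv (alpha k) (state_gain h H x *m theta) <= beta k].

(* max_(x in F) n_F . X(x) < 0 *)
Definition max_outflow_neg (R : realType) (n : nat)
    (X : 'cV[R]_n -> 'cV[R]_n) (lo hi : 'cV[R]_n) (F : facet_index n) : Prop :=
  exists2 m : R,
    is_max [set dotv (outer_normal R F) (X x) | x in facet lo hi F] m & m < 0.

(* x solves x' = X(x) on [0, T[, where T may be +oo; the values of x outside
   [0, T[ are irrelevant.  When X is continuous, the equation at 0 (with the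
   right derivative) follows from the continuity of x at 0. *)
Definition solution (R : realType) (n : nat) (X : 'cV[R]_n -> 'cV[R]_n)
    (T : \bar R) (x : R -> 'cV[R]_n) : Prop :=
  [/\ (0 < T)%E,
      {within [set t : R | 0 <= t /\ (t%:E < T)%E], continuous x} &
      forall t : R, 0 < t -> (t%:E < T)%E -> is_derive t 1 x (X (x t))].

Definition maximal_solution (R : realType) (n : nat)
    (X : 'cV[R]_n -> 'cV[R]_n) (T : \bar R) (x : R -> 'cV[R]_n) : Prop :=
  solution X T x /\
  forall (T' : \bar R) (x' : R -> 'cV[R]_n), (T < T')%E -> solution X T' x' ->
    ~ (forall t : R, 0 <= t -> (t%:E < T)%E -> x' t = x t).

(* Main.v *)
Require Import Defs.
From HB Require Import structures.
From mathcomp Require Import all_boot all_order all_algebra.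
From mathcomp Require Import all_classical all_reals all_analysis.
From mathcomp Require mpoly.
From mathcomp Require Import ring lra.

Set Implicit Arguments.
Unset Strict Implicit.
Unset Printing Implicit Defensive.

Import Order.TTheory GRing.Theory Num.Theory.
Import numFieldNormedType.Exports.

Local Open Scope classical_set_scope.
Local Open Scope ring_scope.

(** Invariance.  On a facet of the rectangle the outward component of the field
    is negative, so a coordinate that touches its bound is pushed back: by
    continuity its derivative keeps that sign for a short time, and the mean
    value theorem keeps the coordinate on the right side of its bound.  The
    infimum of the times spent outside therefore cannot be a time at which the
    trajectory sits in the rectangle, whereas closedness puts it there
    ([rectangle_invariant]).

    Completeness.  Suppose that a trajectory is maximal on [0, r[ with r
    finite.  It stays in the rectangle, so only the restriction of the field
    to the rectangle matters; precomposing with the coordinatewise projection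
    onto the rectangle gives a field that is bounded and Lipschitz on the
    whole space ([box_proj_lipschitz]).  Picard iteration for this field
    ([picard]) produces solutions that live for a time d which does not depend
    on the starting point.  Restarting at a time t0 in ]r - d, r[ gives a
    solution beyond r.  It agrees with the trajectory on [t0, r[ by uniqueness
    ([solution_unique]), and by invariance it stays in the rectangle, where
    the projected field and the original field coincide.  Gluing the two
    contradicts maximality ([solution_prolongs]).  Restarting strictly before
    r spares any discussion of the limit of the trajectory at r.

    Existence and uniqueness both come from [integral_halves_distance]: over a
    time d, integrating the field along two curves halves their distance.

    Polynomials enter only through the closure properties of continuous
    functions, and of bounded Lipschitz functions on the rectangle, under sums
    and products ([closure_closed_loop]). *)

(** * Vector-valued functions, coordinate by coordinate *)

Section Coordinates.
Variables (R : realType) (n : nat).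
Implicit Types (x : 'cV[R]_n).

Lemma coord_le_norm x i : `|x i 0| <= `|x|.
Proof.
rewrite [leRHS]/Num.Def.normr/= mx_normrE.
exact: (le_bigmax _ (fun ij : 'I_n * 'I_1 => `|x ij.1 ij.2|) (i, 0)).
Qed.

Lemma norm_le_coord x d : 0 <= d -> (forall i, `|x i 0| <= d) -> `|x| <= d.
Proof.
move=> d0 xd; rewrite /Num.Def.normr/= mx_normrE.
by apply: bigmax_le => // -[i j] _ /=; rewrite (ord1 j).
Qed.

Lemma within_coord (A : set R) (x : R -> 'cV[R]_n) i :
  {within A, continuous x} -> {within A, continuous (fun t => x t i 0)}.
Proof.
move=> cx t.
exact: (continuous_comp (cx t) (@coord_continuous R n 1 i 0 (x t))).
Qed.

Lemma is_derive_coord (x : R -> 'cV[R]_n) (t : R) (v : 'cV[R]_n) :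
  is_derive t 1 x v <-> forall i, is_derive t 1 (fun s : R => x s i 0) (v i 0).
Proof.
split=> [[dx <-] i|dx].
  by split; [exact: ((derivable_mxP x t 1).1 dx)|rewrite derive_mx// mxE].
have dx' : derivable x t 1.
  by apply/derivable_mxP => i j; rewrite (ord1 j);
    exact: (@ex_derive _ _ _ _ _ _ _ (dx i)).
split=> //; rewrite derive_mx//; apply/matrixP => i j; rewrite mxE (ord1 j).
exact: derive_val.
Qed.

End Coordinates.

(** * Mean value bound and antiderivatives *)

Section RealLine.
Variable R : realType.

Lemma le0_of_geometric (x C : R) :
  (forall k, x <= C * 2^-1 ^+ k) -> x <= 0.
Proof.
move=> xC.
have h : geometric C (2^-1) @ \oo --> (0 : R).
  by apply: cvg_geometric; rewrite ger0_norm ?invr_ge0// invf_lt1 ?ltr1n.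
rewrite -(cvg_lim _ h)//; apply: limr_ge; first exact: cvgP h.
by near=> k; exact: xC.
Unshelve. all: by end_near. Qed.

Lemma mean_value_bound (n : nat) (u v : R -> 'cV[R]_n) (a b C : R) :
  a <= b -> {within `[a, b], continuous u} ->
  (forall t, a < t < b -> is_derive t 1 u (v t)) ->
  0 <= C -> (forall t, a < t < b -> `|v t| <= C) ->
  `|u b - u a| <= C * (b - a).
Proof.
rewrite le_eqVlt => /predU1P[<-|ab] cu du C0 vC.
  by rewrite !subrr normr0 mulr0.
apply: norm_le_coord => [|i]; first by rewrite mulr_ge0 ?subr_ge0// ltW.
have [|c /itvP cab] := @MVT R (fun t => u t i 0) (fun t => v t i 0) a b ab _
  (within_coord cu).
  by move=> t; rewrite in_itv/= => /du/is_derive_coord.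
rewrite !mxE => ->; rewrite normrM (@ger0_norm _ (b - a)) ?subr_ge0 ?(ltW ab)//.
rewrite ler_wpM2r ?subr_ge0 ?(ltW ab)// (le_trans (coord_le_norm _ _))//.
by rewrite vC// !cab.
Qed.

(** The integral is based at [b], strictly left of the prescribed point [a],
    so that [a] itself is a point of two-sided differentiability. *)
Lemma antiderivative (n : nat) (v : R -> 'cV[R]_n) (b a c : R) (x0 : 'cV[R]_n) :
  b < a < c -> continuous v ->
  exists u : R -> 'cV[R]_n,
    u a = x0 /\ forall t, b < t < c -> is_derive t 1 u (v t).
Proof.
move=> /andP[ba ac] cv.
pose I i (t : R) : R :=
  (\int[lebesgue_measure]_(s in [set` `[b, t]]) (v s i 0))%R.
have dI i t : b < t < c -> is_derive t 1 (I i) (v t i 0).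
  move=> /andP[bt tc].
  have ci : continuous (fun s => v s i 0).
    move=> s.
    exact: (continuous_comp (cv s) (@coord_continuous R n 1 i 0 (v s))).
  have [||d e] := @continuous_FTC1_closed R (fun s => v s i 0) b t c tc _ bt.
  - apply: continuous_compact_integrable; first exact: segment_compact.
    exact: continuous_subspaceT.
  - exact: ci.
  by split => //; rewrite -derive1E.
exists (fun t => x0 + \col_i (I i t - I i a)); split.
  by apply/matrixP => i j; rewrite !mxE subrr addr0.
move=> t tbc; apply/is_derive_coord => i.
have -> : (fun s => (x0 + \col_i0 (I i0 s - I i0 a)) i 0)
        = (I i + cst (x0 i 0 - I i a)).
  by apply/funext => s; rewrite !mxE /= fctE /=; ring.
have := dI i t tbc => d.
by apply: is_derive_eq; rewrite addr0.
Qed.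

End RealLine.

(** * Forward invariance of the rectangle *)

Section ScalarBound.
Variable R : realType.

(** Either [phi a] is strictly below [h] and continuity suffices, or it equals
    [h] and the negative derivative, which stays negative just after [a],
    makes [phi] decrease from [h]. *)
Lemma le_right_nbhs (phi psi : R -> R) (a b h : R) : a < b ->
  {within `[a, b], continuous phi} ->
  (forall t, a < t < b -> is_derive t 1 phi (psi t)) ->
  psi t @[t --> a^'+] --> psi a ->
  phi a <= h -> (phi a = h -> psi a < 0) ->
  \forall t \near a^'+, phi t <= h.
Proof.
move=> ab cphi dphi cpsi.
rewrite le_eqVlt => /predU1P[phia|phia] psia; last first.
  have [_ cphia _] := (continuous_within_itvP phi ab).1 cphi.
  by near do apply: ltW; exact: (cvgr_lt _ cphia).
have [e /= e0 epsi] := cvgr_lt _ cpsi _ (psia phia).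
near=> t.
have at_ : a < t by near: t; exact: nbhs_right_gt.
have tb : t < b by near: t; exact: nbhs_right_lt.
have [||c /itvP cat phit] := @MVT R phi psi a t at_.
- move=> s; rewrite in_itv/= => /andP[as_ st].
  by apply: dphi; rewrite as_ (lt_trans st tb).
- apply: continuous_subspaceW cphi.
  by apply: subset_itvl; rewrite bnd_simp ltW.
rewrite -phia -subr_le0 phit mulr_le0_ge0 ?subr_ge0 ?(ltW at_)// ltW//.
have ac : a < c by rewrite cat.
apply: epsi => //=; rewrite ltr0_norm ?subr_lt0// opprB.
apply: (@lt_trans _ _ (t - a)); first by rewrite ltrD2r cat.
by near: t; exact: nbhs_right_ltDr.
Unshelve. all: by end_near. Qed.

End ScalarBound.

Section Invariance.
Variables (R : realType) (n : nat).
Variables (lo hi : 'cV[R]_n) (X : 'cV[R]_n -> 'cV[R]_n).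

(** The blocking condition on the facets, read on the coordinates of the
    field; the sign of the outer normal is resolved once and for all. *)
Definition inward : Prop :=
  forall j x, rectangle lo hi x ->
    (x j 0 = lo j 0 -> 0 < X x j 0) /\ (x j 0 = hi j 0 -> X x j 0 < 0).

Lemma blocked_inward :
  (forall F, max_outflow_neg X lo hi F) -> inward.
Proof.
move=> blocked j x Rx.
have flow b : x j 0 = (if b then hi j 0 else lo j 0) ->
    dotv (outer_normal R (j, b)) (X x) < 0.
  move=> xj; have [m [_ ubm] m0] := blocked (j, b).
  by apply: le_lt_trans m0; apply: ubm; exists x.
have pick_coord :
    \sum_(i < n) (delta_mx j 0 : 'cV[R]_n) i 0 * X x i 0 = X x j 0.
  rewrite (bigD1 j)//= mxE !eqxx mul1r big1 ?addr0// => i ij.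
  by rewrite mxE (negbTE ij) mul0r.
split=> xj; [have := flow false xj|have := flow true xj];
  rewrite /dotv /outer_normal/=.
  under eq_bigr do rewrite mxE mulNr.
  by rewrite sumrN pick_coord oppr_lt0.
by rewrite pick_coord.
Qed.

Lemma inward_right_nbhs (x : R -> 'cV[R]_n) (a b : R) :
  inward -> (forall j, continuous (fun z => X z j 0)) -> a < b ->
  {within `[a, b], continuous x} ->
  (forall t, a < t < b -> is_derive t 1 x (X (x t))) ->
  rectangle lo hi (x a) -> \forall t \near a^'+, rectangle lo hi (x t).
Proof.
move=> inw cX ab cx dx Rxa.
have [_ cxa _] := (continuous_within_itvP x ab).1 cx.
have cXi i : X (x t) i 0 @[t --> a^'+] --> X (x a) i 0.
  exact: (cvg_comp _ _ cxa (cX i (x a))).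
suff : \forall t \near a^'+, forall i, lo i 0 <= x t i 0 <= hi i 0 by [].
apply: filter_forall => i.
have /andP[lxa xha] := Rxa i.
have [inw_lo inw_hi] := inw i (x a) Rxa.
have dxi t : a < t < b -> is_derive t 1 (fun s : R => x s i 0) (X (x t) i 0).
  by move=> /dx/is_derive_coord.
have lower : \forall t \near a^'+, - x t i 0 <= - lo i 0.
  apply: (@le_right_nbhs R (fun t => - x t i 0) (fun t => - X (x t) i 0) a b)
    => //.
  - by move=> t; apply: continuousN; exact: within_coord.
  - by move=> t /dxi d; exact: is_deriveN.
  - exact: cvgN.
  - by rewrite lerN2.
  - by move=> /oppr_inj/inw_lo; rewrite oppr_lt0.
have upper : \forall t \near a^'+, x t i 0 <= hi i 0.
  by apply: (le_right_nbhs ab (within_coord (i := i) cx) dxi) => //; exact: cXi.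
by near=> t; apply/andP; split; [rewrite -lerN2|]; near: t.
Unshelve. all: by end_near. Qed.

(** The infimum [c] of the bad times would be a time at which the trajectory is
    in the rectangle, by closedness, and from which it remains there for a
    while, by [inward_right_nbhs]. *)
Lemma rectangle_invariant (x : R -> 'cV[R]_n) (a b : R) :
  inward -> (forall j, continuous (fun z => X z j 0)) -> a <= b ->
  {within `[a, b], continuous x} ->
  (forall t, a < t < b -> is_derive t 1 x (X (x t))) ->
  rectangle lo hi (x a) -> rectangle lo hi (x b).
Proof.
move=> inw cX; rewrite le_eqVlt => /predU1P[<-//|ab] cx dx Rxa.
apply: contrapT => nRxb.
pose B := [set t | a <= t <= b /\ ~ rectangle lo hi (x t)].
have Bb : B b by rewrite /B/= lexx (ltW ab).
have Binf : has_inf B.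
  by split; [exists b|exists a => t [/andP[]]].
pose c := inf B.
have ac : a <= c by apply: lb_le_inf; [exists b|move=> t [/andP[]]].
have cb : c <= b by apply: ge_inf => //; exact: Binf.2.
have before t : a <= t < c -> rectangle lo hi (x t).
  move=> /andP[at_ tc]; apply: contrapT => nRt.
  have : c <= t.
    apply: ge_inf; first exact: Binf.2.
    by split => //; rewrite at_ (le_trans (ltW tc)).
  by rewrite leNgt tc.
have Rxc : rectangle lo hi (x c).
  move: ac; rewrite le_eqVlt => /predU1P[<-//|ac] i.
  have cxc : x t i 0 @[t --> c^'-] --> x c i 0.
    have cac : {within `[a, c], continuous (fun t => x t i 0)}.
      apply: within_coord; apply: continuous_subspaceW cx.
      by apply: subset_itvl; rewrite bnd_simp.
    by have [] := (continuous_within_itvP _ ac).1 cac.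
  have nearR : \forall t \near c^'-, lo i 0 <= x t i 0 <= hi i 0.
    near=> t; apply: before; apply/andP; split; near: t.
      exact: nbhs_left_ge.
    exact: nbhs_left_lt.
  rewrite -(cvg_lim _ cxc)//; apply/andP; split.
    apply: limr_ge; first exact: cvgP cxc.
    by apply: filterS nearR => t /andP[].
  apply: limr_le; first exact: cvgP cxc.
  by apply: filterS nearR => t /andP[].
have {}cb : c < b.
  by rewrite lt_neqAle cb andbT; apply/eqP => cb'; apply: nRxb; rewrite -cb'.
have : \forall t \near c^'+, rectangle lo hi (x t).
  apply: (inward_right_nbhs (b := b)) => //.
    apply: continuous_subspaceW cx.
    by apply: subset_itvr; rewrite bnd_simp.
  by move=> t /andP[ct tb]; apply: dx; rewrite tb (le_lt_trans ac ct).
move=> [e /= e0 eR].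
have [t [/andP[at_ tb] nRt] tce] := inf_adherent e0 Binf.
apply: (nRt); have : c <= t.
  by apply: ge_inf; [exact: Binf.2|split=> //; apply/andP].
rewrite le_eqVlt => /predU1P[<-//|ct]; apply: eR => //=.
by rewrite ltr0_norm ?subr_lt0// opprB ltrBlDl.
Unshelve. all: by end_near. Qed.

End Invariance.

(** * Clamping a real number to an interval *)

Section Clamp.
Variable R : realType.

Definition clamp (a b t : R) : R := Num.max a (Num.min b t).

Lemma clamp_itv a b t : a <= b -> a <= clamp a b t <= b.
Proof. by move=> ab; rewrite /clamp le_max lexx ge_max ab ge_min lexx. Qed.

Lemma clamp_id a b t : a <= t <= b -> clamp a b t = t.
Proof. by move=> /andP[at_ tb]; rewrite /clamp min_r// max_r. Qed.

Lemma clamp_dist a b s t : `|clamp a b s - clamp a b t| <= `|s - t|.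
Proof.
wlog st : s t / s <= t => [wl|].
  case: (leP s t) => [|/ltW] st; first exact: (wl s t st).
  by rewrite distrC (distrC s); exact: (wl t s st).
have mono : clamp a b s <= clamp a b t.
  by rewrite /clamp ge_max le_max lexx/= le_max le_min !ge_min lexx st ?orbT.
rewrite ler0_norm ?subr_le0// ler0_norm ?subr_le0// !opprB.
rewrite /clamp.
by case: (leP b t) => ?; case: (leP b s) => ?; case: (leP a b) => ?;
  case: (leP a s) => ?; case: (leP a t) => ?; lra.
Qed.

End Clamp.

(** * Picard iteration for a bounded Lipschitz field *)

Lemma lipschitz_continuous (R : realType) (V W : normedModType R)
    (f : V -> W) (C : R) :
  (forall x y, `|f x - f y| <= C * `|x - y|) -> continuous f.
Proof.
move=> fC x; apply/cvgrPdist_lt => e e0.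
have C0 : 0 < `|C| + 1 by rewrite ltr_wpDl.
near=> y.
apply: (le_lt_trans (fC x y)).
apply: (@le_lt_trans _ _ ((`|C| + 1) * `|x - y|)).
  by rewrite ler_wpM2r// ler_wpDr// ler_norm.
rewrite -ltr_pdivlMl//; near: y.
by apply: cvgr_dist_lt; rewrite ?mulr_gt0 ?invr_gt0//; exact: cvg_id.
Unshelve. all: by end_near. Qed.

(** The factor [2] is the sum of the geometric series of the steps.  The limit
    is taken coordinate by coordinate, and the bound on the tails passes to
    it. *)
Lemma geometric_limit (R : realType) (n : nat) (w : nat -> 'cV[R]_n) (C : R) :
  (forall k, `|w k.+1 - w k| <= C * 2^-1 ^+ k) ->
  exists l, forall k, `|w k - l| <= C * 2 * 2^-1 ^+ k.
Proof.
move=> wC.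
have C0 : 0 <= C.
  by have := le_trans (normr_ge0 _) (wC 0%N); rewrite expr0 mulr1.
have tail k m : `|w (k + m)%N - w k| <= C * 2 * 2^-1 ^+ k * (1 - 2^-1 ^+ m).
  elim: m => [|m IH]; first by rewrite addn0 !subrr normr0 mulr0.
  rewrite addnS -(subrKA (w (k + m)%N)).
  apply: (le_trans (ler_normD _ _)); apply: (le_trans (lerD (wC _) IH)).
  by rewrite exprD (exprSr _ m); set p := _ ^+ k; set q := _ ^+ m; lra.
have tail' k m : `|w (k + m)%N - w k| <= C * 2 * 2^-1 ^+ k.
  apply: (le_trans (tail k m)); apply: ler_piMr.
    by rewrite !mulr_ge0 ?exprn_ge0.
  by rewrite lerBlDr ler_wpDr ?exprn_ge0.
have cvgw i : cvgn (fun k => w k i 0).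
  apply/cauchy_cvgP/cauchy_exP => e e0.
  have [K hK] : exists K, C * 2 * 2^-1 ^+ K < e.
    apply: contrapT => /forallNP nK.
    have : e <= 0.
      apply: (@le0_of_geometric _ _ (C * 2)) => k.
      by rewrite leNgt; apply/negP; exact: nK.
    by rewrite leNgt e0.
  exists (w K i 0), K => // m /= Km.
  apply: le_lt_trans hK; rewrite distrC -(subnKC Km).
  apply: le_trans (tail' K (m - K)%N).
  by have := coord_le_norm (w (K + (m - K))%N - w K) i; rewrite !mxE.
exists (\col_i limn (fun k => w k i 0)) => k.
apply: norm_le_coord => [|i]; first by rewrite !mulr_ge0// exprn_ge0.
rewrite !mxE distrC.
have h : `|w m i 0 - w k i 0| @[m --> \oo] -->
    `|limn (fun k => w k i 0) - w k i 0|.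
  by apply: cvg_norm; apply: cvgB; [exact: cvgw|exact: cvg_cst].
rewrite -(cvg_lim _ h)//; apply: limr_le; first exact: cvgP h.
near=> m.
have km : (k <= m)%N by near: m; exists k.
rewrite -(subnKC km); apply: le_trans (tail' k (m - k)%N).
by have := coord_le_norm (w (k + (m - k))%N - w k) i; rewrite !mxE.
Unshelve. all: by end_near. Qed.

Section Picard.
Variables (R : realType) (n : nat) (F : 'cV[R]_n -> 'cV[R]_n) (M L d : R).
Hypothesis F_bounded : forall x, `|F x| <= M.
Hypothesis F_lipschitz : forall x y, `|F x - F y| <= L * `|x - y|.
Hypotheses (L_ge0 : 0 <= L) (d_gt0 : 0 < d) (small_step : L * d <= 2^-1).

Let M_ge0 : 0 <= M.
Proof. exact: le_trans (F_bounded 0). Qed.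

(** The contraction estimate: [u] and [v] are the integral curves of [F] along
    [u1] and [v1].  Uniqueness uses it with [u1 = u] and [v1 = v], existence
    with the Picard iterates and their limit. *)
Lemma integral_halves_distance (u v u1 v1 : R -> 'cV[R]_n) (a b C : R) :
  a <= b <= a + d -> u a = v a ->
  {within `[a, b], continuous u} -> {within `[a, b], continuous v} ->
  (forall t, a < t < b -> is_derive t 1 u (F (u1 t))) ->
  (forall t, a < t < b -> is_derive t 1 v (F (v1 t))) ->
  0 <= C -> (forall t, a < t < b -> `|u1 t - v1 t| <= C) ->
  `|u b - v b| <= C / 2.
Proof.
move=> /andP[ab bd] uva cu cv du dv C0 uvC.
have := @mean_value_bound R n (fun t => u t - v t)
  (fun t => F (u1 t) - F (v1 t)) a b (L * C) ab.
rewrite uva subrr subr0.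
move=> /(_ _ _ _ _)/le_trans; apply.
- by move=> t; exact: (cvgB (cu t) (cv t)).
- by move=> t tab; have := du t tab; have := dv t tab => *; exact: is_deriveB.
- exact: mulr_ge0.
- move=> t tab; apply: (le_trans (F_lipschitz _ _)).
  by rewrite ler_wpM2l// uvC.
- rewrite mulrAC mulrC ler_wpM2l//; apply: le_trans small_step.
  by rewrite ler_wpM2l// lerBlDl.
Qed.

(** A bound [C] on the distance of the two solutions improves to [C / 2], hence
    to [C / 2 ^ k] for every [k]. *)
Lemma solution_unique (u v : R -> 'cV[R]_n) (a b C : R) :
  a <= b <= a + d -> u a = v a ->
  {within `[a, b], continuous u} -> {within `[a, b], continuous v} ->
  (forall t, a < t < b -> is_derive t 1 u (F (u t))) ->
  (forall t, a < t < b -> is_derive t 1 v (F (v t))) ->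
  (forall t, a < t < b -> `|u t - v t| <= C) ->
  u b = v b.
Proof.
move=> /andP[ab bd] uva cu cv du dv uvC.
have halve E t : 0 <= E -> (forall s, a < s < b -> `|u s - v s| <= E) ->
    a < t <= b -> `|u t - v t| <= E / 2.
  move=> E0 uvE /andP[at_ tb].
  have sub : `[a, t] `<=` `[a, b] by apply: subset_itvl; rewrite bnd_simp.
  have st_ab s : a < s < t -> a < s < b.
    by move=> /andP[-> st]; exact: lt_le_trans st tb.
  apply: (@integral_halves_distance u v u v a t) => //.
  - by rewrite (ltW at_) (le_trans tb).
  - exact: continuous_subspaceW cu.
  - exact: continuous_subspaceW cv.
  - by move=> s /st_ab; exact: du.
  - by move=> s /st_ab; exact: dv.
  - by move=> s /st_ab; exact: uvE.
pose D := Num.max C 0.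
have D0 : 0 <= D by rewrite le_max lexx orbT.
have close k : forall t, a < t <= b -> `|u t - v t| <= D / 2 * 2^-1 ^+ k.
  elim: k => [|k IH] t tab.
    rewrite expr0 mulr1; apply: halve tab => // s sab.
    by rewrite le_max uvC.
  rewrite exprSr mulrA; apply: halve tab.
    by rewrite !mulr_ge0 ?exprn_ge0.
  by move=> s /andP[as_ sb]; apply: IH; rewrite as_ ltW.
move: ab; rewrite le_eqVlt => /predU1P[<-//|ab].
apply/eqP; rewrite -subr_eq0 -normr_le0.
apply: (@le0_of_geometric _ _ (D / 2)) => k.
by rewrite close// ab lexx.
Qed.

(** The Picard operator applied to [v].  Freezing the result outside the
    interval from [a] to [a + d] by clamping the time makes it Lipschitz on the
    whole line, so that iterates and limits can be compared at all times. *)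
Lemma picard_step (a : R) (x0 : 'cV[R]_n) (v : R -> 'cV[R]_n) :
  continuous v -> exists w : R -> 'cV[R]_n,
    [/\ w a = x0, forall s t, `|w s - w t| <= M * `|s - t|,
        forall t, w t = w (clamp a (a + d) t) &
        forall t, a < t < a + d -> is_derive t 1 w (F (v t))].
Proof.
move=> cv.
have aad : a <= a + d by rewrite lerDl ltW.
have cFv : continuous (F \o v).
  move=> t; apply: continuous_comp; first exact: cv.
  exact: lipschitz_continuous F_lipschitz _.
(* A margin of 1 on both sides makes [a] and [a + d] interior points. *)
have [|u [ua du]] :=
    @antiderivative R n (F \o v) (a - 1) a (a + d + 1) x0 _ cFv.
  by rewrite ltrBlDr ltrDl ltr01/= -addrA ltrDl addr_gt0.
pose w t := u (clamp a (a + d) t).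
have dwu t : a < t < a + d -> is_derive t 1 u (F (v t)).
  by move=> /andP[at_ td]; apply: du; apply/andP; split; lra.
exists w; split.
- by rewrite /w clamp_id// lexx.
- move=> s t.
  suff lip p q : a <= p <= a + d -> a <= q <= a + d -> p <= q ->
      `|u q - u p| <= M * (q - p).
    have cs := clamp_itv s aad; have ct := clamp_itv t aad.
    have := @clamp_dist R a (a + d) s t; rewrite /w.
    move: (clamp a (a + d) s) (clamp a (a + d) t) cs ct => p q cp cq pq_st.
    apply: (@le_trans _ _ (M * `|p - q|)); last by rewrite ler_wpM2l.
    case: (leP p q) => [pq|/ltW qp].
      by rewrite distrC (distrC p) (@ger0_norm _ (q - p)) ?subr_ge0// lip.
    by rewrite (@ger0_norm _ (p - q)) ?subr_ge0// lip.
  move=> /andP[ap pd] /andP[aq qd] pq.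
  apply: (@mean_value_bound R n u (F \o v)) => //.
  - apply: continuous_in_subspaceT => r; rewrite inE/= in_itv/= => /andP[pr rq].
    have [|dur _] := du r; first by apply/andP; split; lra.
    exact/differentiable_continuous/derivable1_diffP.
  - by move=> r /andP[pr rq]; apply: du; apply/andP; split; lra.
  - by move=> r _; exact: F_bounded.
- by move=> t; rewrite /w (clamp_id (clamp_itv t aad)).
- move=> t /andP[at_ td].
  apply: (@near_eq_is_derive _ _ _ u); last by apply: dwu; rewrite at_.
  near=> s; rewrite /w clamp_id//; apply/andP; split; apply: ltW; near: s.
    exact: lt_nbhsr.
  exact: lt_nbhsl.
Unshelve. all: by end_near. Qed.

(** The iterates converge geometrically and uniformly.  Their common Lipschitz
    constant passes to the limit [y], so that the operator [G] applies to [y],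
    and the contraction estimate identifies [G y] with [y]. *)
Lemma picard (a : R) (x0 : 'cV[R]_n) : exists y : R -> 'cV[R]_n,
  [/\ y a = x0, continuous y &
      forall t, a < t < a + d -> is_derive t 1 y (F (y t))].
Proof.
have aad : a <= a + d by rewrite lerDl ltW.
have /choice[G GP] : forall v : R -> 'cV[R]_n, exists w : R -> 'cV[R]_n,
    continuous v -> [/\ w a = x0,
    forall s t, `|w s - w t| <= M * `|s - t|,
    forall t, w t = w (clamp a (a + d) t) &
    forall t, a < t < a + d -> is_derive t 1 w (F (v t))].
  move=> v; have [/(picard_step a x0)[w wP]|nv] := pselect (continuous v).
    by exists w.
  by exists v.
have G_half (u v : R -> 'cV[R]_n) (C : R) :
    continuous u -> continuous v -> 0 <= C ->
    (forall t, `|u t - v t| <= C) -> forall t, `|G u t - G v t| <= C / 2.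
  move=> cu cv C0 uvC t.
  have [Gua Gu_lip Gu_clamp dGu] := GP u cu.
  have [Gva Gv_lip Gv_clamp dGv] := GP v cv.
  rewrite Gu_clamp Gv_clamp; have /andP[ac cd] := clamp_itv t aad.
  apply: (@integral_halves_distance (G u) (G v) u v a) => //.
  - by rewrite ac.
  - by rewrite Gua.
  - exact/continuous_subspaceT/lipschitz_continuous/Gu_lip.
  - exact/continuous_subspaceT/lipschitz_continuous/Gv_lip.
  - by move=> s /andP[as_ sc]; apply: dGu; rewrite as_ (lt_le_trans sc).
  - by move=> s /andP[as_ sc]; apply: dGv; rewrite as_ (lt_le_trans sc).
pose w k : R -> 'cV[R]_n := iter k G (cst x0).
have cw k : continuous (w k).
  elim: k => [|k IH]; first by move=> t; exact: cvg_cst.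
  by have [_ lip _ _] := GP _ IH; exact: lipschitz_continuous lip.
have w_step (t : R) k : `|w k.+1 t - w k t| <= M * d * 2^-1 ^+ k.
  elim: k t => [|k IH] t.
    have [wa lip wc _] := GP _ (cw 0%N).
    rewrite expr0 mulr1 (_ : w 1%N = G (w 0%N))// wc.
    rewrite (_ : w 0%N t = G (w 0%N) a)//.
    apply: (le_trans (lip _ _)); rewrite ler_wpM2l//.
    have /andP[ac cd] := clamp_itv t aad.
    by rewrite ger0_norm ?subr_ge0// lerBlDl.
  rewrite exprSr mulrA; apply: (G_half _ _ _ (cw k.+1) (cw k)) => //.
  by rewrite !mulr_ge0 ?exprn_ge0 ?(ltW d_gt0).
have /choice[y yP] : forall t : R, exists l : 'cV[R]_n, forall k,
    `|w k t - l| <= M * d * 2 * 2^-1 ^+ k.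
  by move=> t; apply: geometric_limit; exact: w_step.
have C0 k : 0 <= M * d * 2 * 2^-1 ^+ k.
  by rewrite !mulr_ge0 ?exprn_ge0 ?(ltW d_gt0).
have y_lip (s t : R) : `|y s - y t| <= M * `|s - t|.
  rewrite -subr_le0; apply: (@le0_of_geometric _ _ (M * d * 2)) => k.
  have [_ lip _ _] := GP _ (cw k).
  have := lip s t; have := yP s k.+1; have := yP t k.+1.
  rewrite (_ : w k.+1 = G (w k))// exprSr mulrA.
  set p := _ * _ ^+ k => h1 h2 h3.
  have := ler_normD (y s - G (w k) s) (G (w k) s - y t).
  have := ler_normD (G (w k) s - G (w k) t) (G (w k) t - y t).
  rewrite !subrKA (distrC (y s) (G (w k) s)); lra.
have cy : continuous y by exact: lipschitz_continuous y_lip.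
have Gy t : G y t = y t.
  apply/eqP; rewrite -subr_eq0 -normr_le0.
  apply: (@le0_of_geometric _ _ (M * d * 2)) => k.
  have h1 : `|G y t - G (w k) t| <= M * d * 2 * 2^-1 ^+ k / 2.
    by apply: (G_half _ _ _ cy (cw k)) => // s; rewrite distrC.
  have h2 := yP t k.+1.
  rewrite -(subrKA (G (w k) t)); apply: (le_trans (ler_normD _ _)).
  apply: (le_trans (lerD h1 h2)).
  by rewrite exprSr mulrA -splitr.
have [ya _ _ dy] := GP y cy.
have {}Gy : G y = y by apply/funext.
by exists y; split=> //; [rewrite -Gy|rewrite Gy in dy].
Qed.

End Picard.

(** * Closed-loop fields are built from coordinates by sums and products *)

Section PolynomialClosure.
Variables (R : realType) (n : nat) (Q : ('cV[R]_n -> R) -> Prop).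
Hypothesis Q_const : forall c, Q (fun=> c).
Hypothesis Q_add : forall u v, Q u -> Q v -> Q (fun x => u x + v x).
Hypothesis Q_mul : forall u v, Q u -> Q v -> Q (fun x => u x * v x).
Hypothesis Q_coord : forall i, Q (fun x => x i 0).

Lemma closure_sum (I : Type) (r : seq I) (u : I -> 'cV[R]_n -> R) :
  (forall i, Q (u i)) -> Q (fun x => \sum_(i <- r) u i x).
Proof.
move=> Qu; elim: r => [|i r IH].
  by under eq_fun do rewrite big_nil; exact: Q_const.
by under eq_fun do rewrite big_cons; exact: Q_add.
Qed.

Lemma closure_prod (I : Type) (r : seq I) (u : I -> 'cV[R]_n -> R) :
  (forall i, Q (u i)) -> Q (fun x => \prod_(i <- r) u i x).
Proof.
move=> Qu; elim: r => [|i r IH].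
  by under eq_fun do rewrite big_nil; exact: Q_const.
by under eq_fun do rewrite big_cons; exact: Q_mul.
Qed.

Lemma closure_exp (u : 'cV[R]_n -> R) k : Q u -> Q (fun x => u x ^+ k).
Proof.
move=> Qu; elim: k => [|k IH].
  by under eq_fun do rewrite expr0; exact: Q_const.
by under eq_fun do rewrite exprS; exact: Q_mul.
Qed.

Lemma closure_meval m (P : mpoly.mpoly m R) (v : 'I_m -> 'cV[R]_n -> R) :
  (forall k, Q (v k)) -> Q (fun x => mpoly.meval (fun k => v k x) P).
Proof.
move=> Qv; under eq_fun do rewrite mpoly.mevalE.
apply: closure_sum => e; apply: Q_mul; first exact: Q_const.
by apply: closure_prod => k; exact: closure_exp.
Qed.

(** Any class of real functions that contains constants and coordinates and is
    stable under sums and products contains the components of the closed-loop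
    field; the composition [H] after [h] is covered because [closure_meval]
    evaluates a polynomial at arbitrary functions of the class. *)
Lemma closure_closed_loop p q (f : 'cV[mpoly.mpoly n R]_n)
    (g : 'M[mpoly.mpoly n R]_(n, p)) (h : 'cV[mpoly.mpoly n R]_q)
    (H : 'M[mpoly.mpoly q R]_(p, q)) (theta : 'cV[R]_q) i :
  Q (fun x => closed_loop f g h H theta x i 0).
Proof.
rewrite /closed_loop /gain_field /state_gain /polymap.
under eq_fun do rewrite !mxE.
apply: Q_add; first exact: closure_meval.
apply: closure_sum => j.
under eq_fun do rewrite !mxE.
apply: Q_mul; last exact: Q_const.
apply: closure_sum => k.
under eq_fun do rewrite !mxE.
apply: Q_mul; first exact: closure_meval.
apply: closure_meval => l.
by under eq_fun do rewrite !mxE; exact: closure_meval.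
Qed.

End PolynomialClosure.

(** * Extending the field from the rectangle to the whole space *)

Section BoundedLipschitz.
Variables (R : realType) (n : nat) (lo hi : 'cV[R]_n).

(** Boundedness is part of the notion because it is what makes products of
    Lipschitz functions Lipschitz. *)
Definition bounded_lipschitz (u : 'cV[R]_n -> R) : Prop :=
  exists2 C : R, 0 <= C & forall x y, rectangle lo hi x -> rectangle lo hi y ->
    `|u x| <= C /\ `|u x - u y| <= C * `|x - y|.

Lemma bounded_lipschitz_const c : bounded_lipschitz (fun=> c).
Proof.
exists `|c| => // x y _ _; split=> //.
by rewrite subrr normr0 mulr_ge0.
Qed.

Lemma bounded_lipschitz_add u v : bounded_lipschitz u -> bounded_lipschitz v ->
  bounded_lipschitz (fun x => u x + v x).
Proof.
move=> [C C0 uC] [D D0 vD]; exists (C + D) => [|x y Rx Ry].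
  exact: addr_ge0.
have [ux uxy] := uC x y Rx Ry; have [vx vxy] := vD x y Rx Ry.
split; first by apply: (le_trans (ler_normD _ _)); exact: lerD.
rewrite opprD addrACA mulrDl; apply: (le_trans (ler_normD _ _)); exact: lerD.
Qed.

Lemma bounded_lipschitz_mul u v : bounded_lipschitz u -> bounded_lipschitz v ->
  bounded_lipschitz (fun x => u x * v x).
Proof.
move=> [C C0 uC] [D D0 vD]; exists (2 * C * D) => [|x y Rx Ry].
  by rewrite !mulr_ge0.
have [ux uxy] := uC x y Rx Ry; have [vx vxy] := vD x y Rx Ry.
have CD0 : 0 <= C * D by exact: mulr_ge0.
split.
  rewrite normrM; apply: (@le_trans _ _ (C * D)); first exact: ler_pM.
  by rewrite -mulrA ler_peMl// ler1n.
have [vy _] := vD y x Ry Rx.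
have -> : u x * v x - u y * v y = u x * (v x - v y) + (u x - u y) * v y by ring.
apply: (le_trans (ler_normD _ _)); rewrite !normrM.
have h1 : `|u x| * `|v x - v y| <= C * (D * `|x - y|) by exact: ler_pM.
have h2 : `|u x - u y| * `|v y| <= C * `|x - y| * D by exact: ler_pM.
apply: (le_trans (lerD h1 h2)).
by rewrite le_eqVlt; apply/orP; left; apply/eqP; ring.
Qed.

Lemma bounded_lipschitz_coord i : bounded_lipschitz (fun x => x i 0).
Proof.
exists (Num.max 1 (`|lo i 0| + `|hi i 0|)) => [|x y Rx _].
  by rewrite le_max ler01.
split.
  rewrite le_max; apply/orP; right; have /andP[lx xh] := Rx i.
  rewrite ler_norml; apply/andP; split.
    apply: le_trans lx; rewrite opprD lerBlDr.
    by rewrite (le_trans (_ : - `|lo i 0| <= lo i 0)) ?ler_wpDr// lerNnormlW.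
  by apply: (le_trans xh); rewrite ler_wpDl// ler_norm.
apply: (@le_trans _ _ `|x - y|).
  by have := coord_le_norm (x - y) i; rewrite !mxE.
by rewrite ler_peMl// le_max lexx.
Qed.

Definition box_proj (x : 'cV[R]_n) : 'cV[R]_n :=
  \col_i clamp (lo i 0) (hi i 0) (x i 0).

Lemma box_proj_rectangle x :
  (forall i, lo i 0 <= hi i 0) -> rectangle lo hi (box_proj x).
Proof. by move=> lohi i; rewrite mxE clamp_itv. Qed.

Lemma box_proj_id x : rectangle lo hi x -> box_proj x = x.
Proof.
by move=> Rx; apply/matrixP => i j; rewrite mxE (ord1 j) clamp_id//; exact: Rx.
Qed.

Lemma box_proj_dist x y : `|box_proj x - box_proj y| <= `|x - y|.
Proof.
apply: norm_le_coord => // i; rewrite !mxE.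
apply: (le_trans (clamp_dist _ _ _ _)).
by have := coord_le_norm (x - y) i; rewrite !mxE.
Qed.

Lemma rectangle_dist x y : rectangle lo hi x -> rectangle lo hi y ->
  `|x - y| <= `|hi - lo|.
Proof.
move=> Rx Ry; apply: norm_le_coord => // i.
have /andP[lx xh] := Rx i; have /andP[ly yh] := Ry i.
apply: le_trans (coord_le_norm _ i); rewrite !mxE.
rewrite (@ger0_norm _ (hi i 0 - lo i 0)); last by lra.
by rewrite ler_norml; apply/andP; split; lra.
Qed.

(** The sum of the constants of the components bounds each of them, hence their
    maximum, which is the norm. *)
Lemma box_proj_lipschitz (X : 'cV[R]_n -> 'cV[R]_n) :
  (forall i, lo i 0 <= hi i 0) ->
  (forall i, bounded_lipschitz (fun x => X x i 0)) ->
  exists2 C, 0 <= C & (forall x, `|X (box_proj x)| <= C) /\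
    (forall x y, `|X (box_proj x) - X (box_proj y)| <= C * `|x - y|).
Proof.
move=> lohi XC.
have /choice[C CX] : forall i, exists C : R, 0 <= C /\
    forall x y, rectangle lo hi x -> rectangle lo hi y ->
    `|X x i 0| <= C /\ `|X x i 0 - X y i 0| <= C * `|x - y|.
  by move=> i; have [C C0 CX] := XC i; exists C.
have C_le i : C i <= \sum_j C j.
  rewrite (bigD1 i)//= lerDl sumr_ge0// => j _; exact: (CX j).1.
have sC0 : 0 <= \sum_j C j by apply: sumr_ge0 => j _; exact: (CX j).1.
have Rp z := box_proj_rectangle z lohi.
exists (\sum_j C j) => //; split=> [x|x y].
  apply: norm_le_coord => // i; apply: le_trans (C_le i).
  by have [] := (CX i).2 _ _ (Rp x) (Rp x).
apply: norm_le_coord => [|i]; first by rewrite mulr_ge0.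
rewrite !mxE; have [_ /le_trans] := (CX i).2 _ _ (Rp x) (Rp y); apply.
by apply: ler_pM => //; [exact: (CX i).1|exact: box_proj_dist].
Qed.

End BoundedLipschitz.

(** * Prolongation of trajectories *)

Section Prolongation.
Variables (R : realType) (n : nat) (lo hi : 'cV[R]_n).
Variable X : 'cV[R]_n -> 'cV[R]_n.
Hypothesis lohi : forall i, lo i 0 <= hi i 0.
Hypothesis X_continuous : forall i, continuous (fun x => X x i 0).
Hypothesis X_lipschitz : forall i, bounded_lipschitz lo hi (fun x => X x i 0).
Hypothesis X_inward : inward lo hi X.

Lemma solution_in_rectangle (T : \bar R) (x : R -> 'cV[R]_n) :
  solution X T x -> rectangle lo hi (x 0) ->
  forall t, 0 <= t -> (t%:E < T)%E -> rectangle lo hi (x t).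
Proof.
move=> [T0 cx dx] Rx0 t t0 tT.
apply: (rectangle_invariant X_inward X_continuous t0) => //.
  apply: continuous_subspaceW cx => s /=; rewrite in_itv/= => /andP[s0 st].
  by split=> //; apply: le_lt_trans tT; rewrite lee_fin.
by move=> s /andP[s0 st]; apply: dx => //; apply: lt_trans tT; rewrite lte_fin.
Qed.

(** The step [d] depends on the Lipschitz constant alone, so that a restart late
    enough before [r] reaches beyond [r]. *)
Lemma solution_prolongs (r : R) (x : R -> 'cV[R]_n) :
  solution X r%:E x -> rectangle lo hi (x 0) ->
  exists T' : R, exists2 z, r < T' & solution X T'%:E z /\
    forall t, t < r -> z t = x t.
Proof.
move=> solx Rx0; have Rx := solution_in_rectangle solx Rx0.
have [r0 cx dx] := solx; move: r0; rewrite lte_fin => r0.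
pose F := X \o box_proj lo hi.
have [C C0 [FC Flip]] := box_proj_lipschitz lohi X_lipschitz.
have F_eq z : rectangle lo hi z -> F z = X z.
  by move=> Rz; rewrite /F/= box_proj_id.
have cF i : continuous (fun z => F z i 0).
  move=> z; exact: (continuous_comp (lipschitz_continuous Flip (x := z))
    (@coord_continuous R n 1 i 0 _)).
have inwF : inward lo hi F.
  by move=> j z Rz; rewrite F_eq//; exact: X_inward.
(* The increment 1 keeps the inverse meaningful for a constant field. *)
pose d : R := (2 * (C + 1))^-1.
have C1 : 0 < C + 1 by rewrite ltr_wpDl.
have d0 : 0 < d by rewrite invr_gt0 mulr_gt0.
have Cd : C * d <= 2^-1.
  by rewrite /d invfM mulrCA ler_piMr// ler_pdivrMr// mul1r lerDl.
(* Both t0 > 0 and t0 > r - d are needed; halving leaves room for each. *)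
pose t0 := Num.max (r / 2) (r - d / 2).
have t00 : 0 < t0 by rewrite lt_max divr_gt0.
have t0r : t0 < r by rewrite gt_max; apply/andP; split; lra.
have rt0 : r < t0 + d.
  have : r - d / 2 <= t0 by rewrite le_max lexx orbT.
  lra.
have Rxt0 : rectangle lo hi (x t0) by apply: Rx; rewrite ?lte_fin// ltW.
have [y [yt0 cy dy]] := picard FC Flip C0 d0 Cd t0 (x t0).
have Ry t : t0 <= t < t0 + d -> rectangle lo hi (y t).
  move=> /andP[t0t td]; apply: (rectangle_invariant inwF cF t0t).
  - exact: continuous_subspaceT.
  - by move=> s /andP[t0s st]; apply: dy; rewrite t0s (lt_trans st).
  - by rewrite yt0.
have xy t : t0 <= t < r -> x t = y t.
  move=> /andP[t0t tr].
  apply: (@solution_unique R n F C d Flip C0 Cd x y t0 t `|hi - lo|) => //.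
  - by rewrite t0t (le_trans (ltW tr)) ?ltW.
  - apply: continuous_subspaceW cx => s /=; rewrite in_itv/= => /andP[s0 st].
    by rewrite lte_fin (le_trans (ltW t00) s0) (le_lt_trans st tr).
  - exact: continuous_subspaceT.
  - move=> s /andP[s0 st].
    have s_gt0 : 0 < s by exact: lt_trans s0.
    have s_lt : (s%:E < r%:E)%E by rewrite lte_fin (lt_trans st).
    rewrite F_eq; [exact: dx|exact: Rx (ltW _) _].
  - move=> s /andP[s0 st]; apply: dy.
    by rewrite s0 (lt_trans st)// (lt_trans tr).
  - move=> s /andP[s0 st]; apply: rectangle_dist.
      by apply: Rx; rewrite ?lte_fin ?(lt_trans st)// ltW// (lt_trans t00).
    by apply: Ry; rewrite (ltW s0) (lt_trans st)// (lt_trans tr).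
(* The curves agree on [t0, r[, so z is locally one of the two solutions
   around every positive time, and no derivative has to be matched at r. *)
pose z t := if t < r then x t else y t.
have zx t : t < r -> z t = x t by rewrite /z => ->.
have zy t : t0 <= t -> z t = y t.
  by move=> t0t; rewrite /z; case: ifPn => // tr; apply: xy; rewrite t0t.
have dz t : 0 < t -> t < t0 + d -> is_derive t 1 z (X (z t)).
  move=> t_gt0 td; case: (ltP t r) => [tr|rt].
    rewrite zx//; apply: (@near_eq_is_derive _ _ _ x).
      by near=> s; rewrite zx//; near: s; exact: lt_nbhsl.
    by apply: dx; rewrite ?lte_fin.
  have t0t : t0 < t by exact: lt_le_trans rt.
  rewrite zy ?(ltW t0t)//; apply: (@near_eq_is_derive _ _ _ y).
    by near=> s; rewrite zy// ltW//; near: s; exact: lt_nbhsr.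
  rewrite -F_eq; first by apply: dy; rewrite t0t.
  by apply: Ry; rewrite (ltW t0t).
exists (t0 + d), z => //; split=> //; split.
- by rewrite lte_fin (lt_trans r0).
- apply/subspace_continuousP => t [t_ge0]; rewrite lte_fin => td.
  move: t_ge0; rewrite le_eqVlt => /predU1P[t_eq0|t_gt0]; last first.
    apply: cvg_within_filter.
    have [dzt _] := dz t t_gt0 td.
    exact/differentiable_continuous/derivable1_diffP.
  have z0 : z 0 = x 0 by exact: zx.
  rewrite -t_eq0 /from_subspace z0 => U Ux0.
  have A0 : [set t : R | 0 <= t /\ (t%:E < r%:E)%E] 0.
    by rewrite /= lexx lte_fin.
  have := (subspace_continuousP _ _).1 cx 0 A0 U Ux0.
  apply: filterS2 (lt_nbhsl r0) => s sr xU [s0 _] /=.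
  by rewrite /from_subspace zx//; apply: xU; split=> //; rewrite lte_fin.
- by move=> t t_gt0; rewrite lte_fin; exact: dz.
Unshelve. all: by end_near. Qed.

End Prolongation.

(** * Invariance under an admissible feedback *)

Theorem theorem2 (R : realType) (n p q : nat)
    (f : 'cV[mpoly.mpoly n R]_n) (g : 'M[mpoly.mpoly n R]_(n, p))
    (h : 'cV[mpoly.mpoly n R]_q) (H : 'M[mpoly.mpoly q R]_(p, q))
    (K : finType) (alpha : K -> 'cV[R]_p) (beta : K -> R)
    (hU : compact (polytope alpha beta))
    (lo hi : 'cV[R]_n) (hlohi : forall i : 'I_n, lo i 0 < hi i 0)
    (OF : facet_index n -> set 'cV[R]_q)
    (hOF : forall (F : facet_index n) (theta : 'cV[R]_q), OF F theta ->
       max_outflow_neg (closed_loop f g h H theta) lo hi F) :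
  let O := admissible_gains h H alpha beta lo hi in
  let OFF := \bigcap_(F in [set: facet_index n]) OF F in
  OFF `&` O !=set0 ->
  forall theta : 'cV[R]_q, (OFF `&` O) theta ->
  closed_loop f g h H theta 0 = 0 ->
  (forall x : 'cV[R]_n, rectangle lo hi x ->
     polytope alpha beta (state_gain h H x *m theta)) /\
  (forall (T : \bar R) (x : R -> 'cV[R]_n),
     solution (closed_loop f g h H theta) T x -> rectangle lo hi (x 0) ->
     (forall t : R, 0 <= t -> (t%:E < T)%E -> rectangle lo hi (x t)) /\
     (maximal_solution (closed_loop f g h H theta) T x -> T = +oo%E)).
Proof.
move=> O OFF _ theta [OFtheta Otheta] _; split.
  by move=> x Rx k; exact: Otheta.
pose X := closed_loop f g h H theta.
have lohi i : lo i 0 <= hi i 0 by exact: ltW.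
have cX i : continuous (fun x => X x i 0).
  apply: (@closure_closed_loop R n (fun u => continuous u)).
  - by move=> c x; exact: (@cst_continuous _ R).
  - by move=> u v cu cv x; exact: (cvgD (cu x) (cv x)).
  - by move=> u v cu cv x; exact: (cvgM (cu x) (cv x)).
  - by move=> j; exact: coord_continuous.
have lX i : bounded_lipschitz lo hi (fun x => X x i 0).
  apply: closure_closed_loop.
  - exact: bounded_lipschitz_const.
  - exact: bounded_lipschitz_add.
  - exact: bounded_lipschitz_mul.
  - exact: bounded_lipschitz_coord.
have inwX : inward lo hi X.
  by apply: blocked_inward => F; apply: hOF; exact: OFtheta.
move=> T x solx Rx0; split.
  exact: solution_in_rectangle cX inwX _ _ solx Rx0.
case: T solx => [r||] solx [_ maxx] //; last by case: solx.
have [T' [z rT' [solz zx]]] := solution_prolongs lohi cX lX inwX solx Rx0.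
exfalso; apply: (maxx T'%:E z _ solz); first by rewrite lte_fin.
by move=> t _; rewrite lte_fin; exact: zx.
Qed.
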